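(* For each positive integer $N$, let $X_N=[x_{ij,N}]_{1\le i,j\le N}$ be an $N\times N$ random matrix with identically distributed and Boolean independent entries from $(\mathcal{A},\varphi)$ such that, for each $(i,j)\in[N]\times[N]$: 1. the limits $$\alpha_m=\lim_{N\to\infty}N\,\varphi\big((x_{ij,N}x_{ij,N}^* )^m\big),\qquad \beta_m=\lim_{N\to\infty}N\,\varphi\big((x_{ij,N}^*x_{ij,N})^m\big)$$ exist for each positive integer $m$; 2. $\displaystyle\lim_{N\to\infty}N^{\varepsilon}\,\varphi\big(x_{ij,N}^{\xi_1}x_{ij,N}^{\xi_2}\cdots x_{ij,N}^{\xi_n}\big)=0$ for all $\varepsilon<1$, all $n\ge1$ and all $n$-tuples $(\xi_1,\dots,\xi_n)\in\{1,*\}^n$. Then the asymptotic distribution of $X_N$ is $B$-diagonal with determining sequences $(\alpha_n)_n$ and $(\beta_n)_n$; that is, there exist a non-commutative probability space $(\mathcal{B},\psi)$, with $\mathcal{B}$ a $*$-algebra, and a $B$-diagonal element $b\in\mathcal{B}$ with determining sequences $(\alpha_n)_n$, $(\beta_n)_n$ such that for all $n\geq 1$ and all $(\xi_1,\dots,\xi_n)\in\{1,*\}^n$, $$\lim_{N\to\infty}\varphi\circ\mathrm{tr}\big(X_N^{\xi_1}\cdots X_N^{\xi_n}\big)=\psi\big(b^{\xi_1}\cdots b^{\xi_n}\big).$$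
   Context: $[N]=\{1,\dots,N\}$. A non-commutative probability space is a pair $(\mathcal{A},\varphi)$ with $\mathcal{A}$ a complex unital algebra and $\varphi:\mathcal{A}\to\mathbb{C}$ a unital $\mathbb{C}$-linear map; here $\mathcal{A}$ is moreover a $*$-algebra, and no positivity of $\varphi$ is required. Elements of $\mathcal{A}$ are called variables; $x^1=x$ and $x^*$ is the adjoint. Boolean independence: a family of (not necessarily unital) subalgebras $\{\mathcal{A}_j\}_j$ of $\mathcal{A}$ is Boolean independent with respect to $\varphi$ if $\varphi(a_1a_2\cdots a_m)=\varphi(a_1)\varphi(a_2)\cdots\varphi(a_m)$ for all $m\ge1$ whenever $a_k\in\mathcal{A}_{i(k)}$ and $i(1)\ne i(2)$, $i(2)\neq i(3)$, ..., $i(m-1)\neq i(m)$ (consecutive indices distinct). A family of variables is Boolean independent if the non-unital $*$-subalgebras they generate are Boolean independent. Variables $x,y$ are identically distributed if $\varphi(x^{\xi_1}\cdots x^{\xi_n})=\varphi(y^{\xi_1}\cdots y^{\xi_n})$ for all $n\geq 1$ and $\xi\in\{1,*\}^n$; in the claim the entries of $X_N$, for each fixed $N$, are identically distributed. Random matrices: $M_N(\mathcal{A})$ is the algebra of $N\times N$ matrices over $\mathcal{A}$, with adjoint $(A^* )_{ij}=(a_{ji})^*$ and functional $\varphi\circ\mathrm{tr}(A)=\frac1N\sum_{i=1}^N\varphi(a_{ii})$. Boolean cumulants: the multilinear maps $\mathfrak{b}_r:\mathcal{A}^r\to\mathbb{C}$ are defined recursively by $$\varphi(a_1\cdots a_n)=\sum_{\pi\in\mathcal{I}(n)}\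 \prod_{V=\{l+1,\dots,l+k\}\in\pi}\mathfrak{b}_k(a_{l+1},\dots,a_{l+k}),$$ where $\mathcal{I}(n)$ is the set of interval partitions of $[n]$ (partitions whose blocks are sets of consecutive integers). $B$-diagonal: a Boolean cumulant $\mathfrak{b}_n(X^{\xi_1},\dots,X^{\xi_n})$, $\xi_k\in\{1,*\}$, is alternating if $n$ is even and $\xi_k\ne\xi_{k+1}$ for all $k\in[n-1]$. An element $X$ (not assumed selfadjoint) is $B$-diagonal if all its non-alternating Boolean cumulants vanish. Its determining sequences are $\alpha_n=\mathfrak{b}_{2n}(X,X^*,\dots,X,X^* )$ and $\beta_n=\mathfrak{b}_{2n}(X^*,X,\dots,X^*,X)$. *)

(* Defs.v *)
From HB Require Import structures.
From mathcomp Require Import all_boot all_order all_algebra.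
From mathcomp Require Import complex.
From mathcomp Require Import all_classical all_reals all_analysis.

Set Implicit Arguments.
Unset Strict Implicit.
Unset Printing Implicit Defensive.

Import Order.TTheory GRing.Theory Num.Theory.
Import numFieldNormedType.Exports.

Local Open Scope ring_scope.

(* [R[i]] is packed as a numClosedFieldType so that the carrier inherits the
   metric topology of its modulus (the library declares no topology on [R[i]]
   itself). *)
Definition CC (R : realType) : numClosedFieldType := R[i].

(* No positivity (not even [phi (star a) = (phi a)^*]) is required. *)
Record starNCPS (R : realType) := StarNCPS {
  carrier :> algType (CC R);
  star : carrier -> carrier;
  starD : forall a b, star (a + b) = star a + star b;
  starZ : forall (c : CC R) a, star (c *: a) = c^* *: star a;
  starM : forall a b, star (a * b) = star b * star a;
  starK : involutive star;
  phi : {scalar carrier};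
  phi1 : phi 1 = 1
}.

Arguments star {R s}.
Arguments phi {R s}.

(* A tuple of exponents in {1, *}^n is a [seq bool] of size n, [true] standing
   for the adjoint; [adj] is the adjoint operation of [T]. *)
Definition wletters (T : Type) (adj : T -> T) (x : T) (xi : seq bool) : seq T :=
  [seq if e then adj x else x | e <- xi].

Definition word (T : pzRingType) (adj : T -> T) (x : T) (xi : seq bool) : T :=
  \prod_(y <- wletters adj x xi) y.

Section Independence.
Variables (R : realType) (A : starNCPS R).
Local Open Scope classical_set_scope.

Definition nonunital_star_subalgebra (S : set A) : Prop :=
  [/\ S 0,
      forall a b, S a -> S b -> S (a + b),
      forall (c : CC R) a, S a -> S (c *: a),
      forall a b, S a -> S b -> S (a * b) &
      forall a, S a -> S (star a)].

(* Only the values of [i] and [a] below [m] matter. *)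
Definition boolean_independent (J : Type) (S : J -> set A) : Prop :=
  forall (m : nat) (i : nat -> J) (a : nat -> A),
    (0 < m)%N ->
    (forall k, (k < m)%N -> S (i k) (a k)) ->
    (forall k, (k.+1 < m)%N -> i k <> i k.+1) ->
    phi (\prod_(k < m) a k) = \prod_(k < m) phi (a k).

Definition boolean_independent_variables (J : Type) (x : J -> A) : Prop :=
  boolean_independent
    (fun j => smallest nonunital_star_subalgebra [set x j]).

Definition identically_distributed (x y : A) : Prop :=
  forall xi : seq bool, (0 < size xi)%N ->
    phi (word star x xi) = phi (word star y xi).

End Independence.

Section Matrices.
Variables (R : realType) (A : starNCPS R) (N : nat).

Definition mxstar (X : 'M[A]_N) : 'M[A]_N := \matrix_(i, j) star (X j i).

Definition phitr (X : 'M[A]_N) : CC R := N%:R^-1 * \sum_(i < N) phi (X i i).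

End Matrices.

Definition interval_partition (n : nat) (P : {set {set 'I_n}}) : bool :=
  finset.partition P [set: 'I_n]%SET &&
  [forall V in P, forall i in V, forall j : 'I_n, forall k in V,
     (i <= j <= k)%N ==> (j \in V)].

Section BooleanCumulants.
Variables (R : realType) (A : starNCPS R).
Implicit Types a : seq A.

Definition subword a (V : {set 'I_(size a)}) : seq A :=
  [seq a`_(nat_of_ord i) | i <- enum V].

(* The moment-cumulant formula solved for the one-block partition; the blocks of
   the other partitions are shorter words, so [size a] is enough fuel. *)
Fixpoint bcumulant_fuel (k : nat) a : CC R :=
  if k is k'.+1 then
    phi (\prod_(x <- a) x) -
    \sum_(P : {set {set 'I_(size a)}} |
            interval_partition P && (P != [set [set: 'I_(size a)]]%SET))
       \prod_(V in P) bcumulant_fuel k' (subword V)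
  else 0.

(* [bcumulant [:: a1; ...; ar]] is b_r(a1, ..., ar), for r >= 1. *)
Definition bcumulant a : CC R := bcumulant_fuel (size a) a.

Lemma size_subword a (V : {set 'I_(size a)}) : size (subword V) = #|V|.
Proof. by rewrite size_map -cardE. Qed.

Lemma subwordT a : subword [set: 'I_(size a)]%SET = a.
Proof.
have -> : subword [set: 'I_(size a)]%SET = [seq a`_(val i) | i <- enum 'I_(size a)].
  by congr map; apply: eq_enum => i; rewrite inE.
rewrite (map_comp (fun i => a`_i) val) val_enum_ord.
by apply: (@eq_from_nth _ 0) => [|i]; rewrite size_map size_iota // => ia;
  rewrite (nth_map 0%N) ?size_iota // nth_iota.
Qed.

Lemma size_subword_lt a (P : {set {set 'I_(size a)}}) V :
  interval_partition P -> P != [set [set: 'I_(size a)]]%SET -> V \in P ->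
  (0 < size (subword V) < size a)%N.
Proof.
move=> /andP[/and3P[/eqP cP tP P0] _] PT VP; rewrite size_subword.
have V0 : V != finset.set0 by apply: contraNneq P0 => <-.
have leV : (#|V| <= size a)%N by have := max_card (mem V); rewrite card_ord.
rewrite card_gt0 V0 /= ltn_neqAle leV andbT.
apply: contra PT => /eqP cV.
have VT : V = [set: 'I_(size a)]%SET.
  by apply/eqP; rewrite eqEcard finset.subsetT cardsT card_ord cV /=.
rewrite -VT; apply/eqP/setP => W; rewrite inE; apply/idP/eqP => [WP|->//].
apply: contraNeq P0 => WV; have := finset.trivIsetP tP _ _ WP VP WV.
by rewrite VT -setI_eq0 finset.setIT => /eqP <-.
Qed.

Lemma bcumulant_fuelE k m a : (0 < size a <= k)%N -> (size a <= m)%N ->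
  bcumulant_fuel k a = bcumulant_fuel m a.
Proof.
elim: k m a => [|k IH] [|m] a /andP[a0 ak] am; rewrite ?leqn0 in am ak;
  try by rewrite ?(eqP am) ?(eqP ak) in a0.
congr (_ - _); apply: eq_bigr => P /andP[Pi PT]; apply: eq_bigr => V VP.
have /andP[V0 Va] := size_subword_lt Pi PT VP.
apply: IH; rewrite ?V0 /=; [exact: leq_trans Va ak | exact: leq_trans Va am].
Qed.

Lemma interval_partitionT n : (0 < n)%N ->
  interval_partition [set [set: 'I_n]]%SET.
Proof.
move=> n0; apply/andP; split.
  apply/and3P; split; first by rewrite cover1.
    by apply/finset.trivIsetP => U V; rewrite !inE => /eqP-> /eqP->; rewrite eqxx.
  by rewrite inE eq_sym -card_gt0 cardsT card_ord.
apply/forall_inP => V; rewrite inE => /eqP ->.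
apply/forall_inP => i _; apply/forallP => j; apply/forall_inP => k _.
by rewrite inE implybT.
Qed.

Lemma moment_bcumulant a : (0 < size a)%N ->
  phi (\prod_(x <- a) x) =
  \sum_(P : {set {set 'I_(size a)}} | interval_partition P)
     \prod_(V in P) bcumulant (subword V).
Proof.
move=> a0; rewrite (bigD1 _ (interval_partitionT a0)) /= big_set1 subwordT.
rewrite {1}/bcumulant -{1}(prednK a0) /= -[LHS](subrK (\sum_(P : {set {set 'I_(size a)}} |
  interval_partition P && (P != [set [set: 'I_(size a)]]%SET))
     \prod_(V in P) bcumulant (subword V))).
congr (_ - _ + _); apply: eq_bigr => P /andP[Pi PT]; apply: eq_bigr => V VP.
have /andP[V0 Va] := size_subword_lt Pi PT VP.
apply: bcumulant_fuelE; first by rewrite V0 leqnn.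
by rewrite -ltnS prednK.
Qed.

Definition alternating (xi : seq bool) : bool :=
  ~~ odd (size xi) && sorted (fun e f => e != f) xi.

Definition B_diagonal (x : A) : Prop :=
  forall xi : seq bool, (0 < size xi)%N -> ~~ alternating xi ->
    bcumulant (wletters star x xi) = 0.

Definition has_determining_sequences (x : A) (alpha beta : nat -> CC R) : Prop :=
  forall n : nat, (0 < n)%N ->
    alpha n = bcumulant (flatten (nseq n [:: x; star x])) /\
    beta n = bcumulant (flatten (nseq n [:: star x; x])).

End BooleanCumulants.

(* Main.v *)
(** The moments of a tuple are recovered from its Boolean cumulants by the
    recursion phi(a_1...a_n) = sum_k b_k(a_1,...,a_k) phi(a_{k+1}...a_n) over the
    first block of an interval partition.  For Boolean independent identically
    distributed entries only blocks of equal entries contribute, so summing over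
    all index paths gives, for the matrix M(xi) of the phi-values of the entries
    of X^xi, the exact recursion
      M(xi) = sum_k b_N(xi_1...xi_k) T_k M(xi_{k+1}...xi_n),
    where T_k is N I if the first k exponents alternate and k is even, the
    all-ones matrix J if they alternate and k is odd, and I otherwise.
    Every b_N is o(N^-eps) for all eps < 1, and N b_N tends to alpha or beta on
    the alternating words of even length; hence M(xi) = t I + s J, where t tends to
    the moment of the B-diagonal distribution and s is o(N^-eps) for all eps < 1,
    so that the normalized trace t + s has the same limit as t.  The limit is
    realized on the free algebra on two letters exchanged by the involution. *)
Require Import Defs.
From HB Require Import structures.
From mathcomp Require Import all_boot all_order all_algebra.
From mathcomp Require Import complex.
From mathcomp Require Import all_classical all_reals all_analysis.
From mathcomp Require monalg.
Import (canonicals, coercions) monalg.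

Set Implicit Arguments.
Unset Strict Implicit.
Unset Printing Implicit Defensive.

Import Order.TTheory GRing.Theory Num.Theory.
Import numFieldNormedType.Exports.

Local Open Scope ring_scope.
Local Open Scope classical_set_scope.

(** * Moments and Boolean cumulants *)

Section BooleanMoment.
Variables (K : comPzRingType) (T : Type).
Implicit Types (f : seq T -> K) (s pre : seq T).

(** [pre] is the block under construction: the next letter either joins it or closes it and opens a
    new one. This accumulator makes the sum over first blocks a structural recursion. *)
Fixpoint boolean_moment_from f pre s : K :=
  if s is y :: s' then
    boolean_moment_from f (rcons pre y) s' + f pre * boolean_moment_from f [:: y] s'
  else f pre.

Definition boolean_moment f s : K :=
  if s is y :: s' then boolean_moment_from f [:: y] s' else 1.

Lemma boolean_moment_fromE f pre s :
  boolean_moment_from f pre s =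
  \sum_(k < (size s).+1) f (pre ++ take k s) * boolean_moment f (drop k s).
Proof.
elim: s pre => [|y s IH] pre; first by rewrite big_ord1 /= cats0 mulr1.
rewrite big_ord_recl /= cats0 addrC (IH (rcons _ _)); congr (_ + _).
by apply: eq_bigr => k _; rewrite cat_rcons.
Qed.

Lemma boolean_momentE f s : (0 < size s)%N ->
  boolean_moment f s =
  \sum_(k < size s) f (take k.+1 s) * boolean_moment f (drop k.+1 s).
Proof. by case: s => // y s _; rewrite [LHS]boolean_moment_fromE. Qed.

(** Strong induction on the length: the first block covering all of [s] contributes [f s] times the
    empty moment 1, and all other terms use [f] on shorter words only, so they cancel. *)
Lemma boolean_moment_inj f g : boolean_moment f =1 boolean_moment g ->
  forall s, (0 < size s)%N -> f s = g s.
Proof.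
move=> fg s; have [n] := ubnP (size s); elim: n s => // n IH s sn s0.
have := fg s; rewrite !boolean_momentE //.
case: s sn s0 => // y s sn _; rewrite !big_ord_recr /= drop_size take_size !mulr1.
have -> : \sum_(k < size s) f (y :: take k s) * boolean_moment f (drop k s) =
          \sum_(k < size s) g (y :: take k s) * boolean_moment g (drop k s).
  apply: eq_bigr => k _; rewrite fg IH //= size_takel ?(ltnW (ltn_ord k)) //.
  exact: leq_ltn_trans (ltn_ord k) sn.
exact: addrI.
Qed.

End BooleanMoment.

Lemma boolean_moment_map (K : comPzRingType) (T U : Type) (h : T -> U)
    (f : seq U -> K) s :
  boolean_moment f (map h s) = boolean_moment (f \o map h) s.
Proof.
case: s => [|y s] //=; rewrite -[[:: h y]]/(map h [:: y]).
elim: s [:: y] => [|z s IH] pre //=.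
by rewrite -map_rcons IH -[[:: h z]]/(map h [:: z]) IH.
Qed.

(** * Interval partitions and their first block *)

Section IntervalPartitions.
Variable n : nat.
Implicit Types (P : {set {set 'I_n}}) (V : {set 'I_n}).
Local Open Scope set_scope.

Definition convex_set V : bool :=
  [forall i in V, forall j : 'I_n, forall k in V, (i <= j <= k)%N ==> (j \in V)].

Lemma convex_setP V :
  reflect (forall i j k : 'I_n, i \in V -> k \in V -> (i <= j <= k)%N -> j \in V)
          (convex_set V).
Proof.
apply: (iffP forall_inP) => [cV i j k iV kV ijk|cV i iV].
  by have /forallP/(_ j)/forall_inP/(_ k kV)/implyP := cV i iV; apply.
by apply/forallP => j; apply/forall_inP => k kV; apply/implyP; apply: cV iV kV.
Qed.

Definition final_segment (m : nat) : {set 'I_n} := [set i : 'I_n | (m <= i)%N].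

Definition interval_set (m k : nat) : {set 'I_n} := [set i : 'I_n | (m <= i <= k)%N].

(** For [m = 0] this is convertible to [interval_partition]; a variable [m] allows first blocks to
    be peeled off one at a time. *)
Definition final_partition (m : nat) P : bool :=
  finset.partition P (final_segment m) && [forall V in P, convex_set V].

(** The block of [m] is taken, with [k] its largest element; convexity fills in everything
    between. *)
Lemma final_partition_first (m : 'I_n) P : final_partition m P ->
  exists2 k : 'I_n, (m <= k)%N & interval_set m k \in P.
Proof.
move=> /andP[/and3P[/eqP cP tP P0] /forall_inP cvP].
have mP : m \in finset.cover P by rewrite cP inE.
have VP := pblock_mem mP; have mV := mP; rewrite -mem_pblock in mV.
move: (finset.pblock P m) VP mV => V VP mV.
have VD i : i \in V -> (m <= i)%N.
  move=> iV; have : i \in finset.cover P by apply/finset.bigcupP; exists V.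
  by rewrite cP inE.
case: (@arg_maxnP _ m (fun i => i \in V) val mV) => k kV kmax.
exists k; first exact: VD.
suff <- : V = interval_set m k by [].
apply/setP => i; rewrite inE; apply/idP/idP => [iV|mik].
  by rewrite VD //; apply: kmax.
exact: (convex_setP _ (cvP _ VP)) mV kV mik.
Qed.

Lemma final_partition_first_uniq (m k l : 'I_n) P : final_partition m P ->
  (m <= k)%N -> (m <= l)%N -> interval_set m k \in P -> interval_set m l \in P ->
  k = l.
Proof.
move=> /andP[/and3P[_ tP _] _] mk ml kP lP.
have [/setP E|/(finset.trivIsetP tP _ _ kP lP)] := eqVneq (interval_set m k) (interval_set m l).
  apply/val_inj/anti_leq; have := E k; have := E l.
  by rewrite !inE !leqnn mk ml /= => -> <-.
move=> /disjointFr/(_ (_ : m \in _)); rewrite !inE leqnn mk ml => /(_ isT).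
by [].
Qed.

(** The equality test on the right expresses that the block belongs to [P], in the form that
    reindexing a sum by deletion of this block produces. *)
Lemma final_partition_cons (m k : 'I_n) P : (m <= k)%N ->
  (final_partition m P && (interval_set m k \in P)) =
  ((interval_set m k |: P :\ interval_set m k == P) &&
   (final_partition k.+1 (P :\ interval_set m k))).
Proof.
move=> mk; set B := interval_set m k.
have BD : final_segment m :\: B = final_segment k.+1.
  apply/setP => i; rewrite !inE; case: (leqP m i) => mi /=; last first.
    by apply/esym/negbTE; rewrite -leqNgt (leq_trans (ltnW mi)) // (leq_trans mk).
  by rewrite andbT ltnNge.
have BU : B :|: final_segment k.+1 = final_segment m.
  rewrite -BD; apply/setP => i; rewrite !inE.
  by case: (leqP m i); case: (leqP i k).
have mB : m \in B by rewrite !inE leqnn.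
have B0 : B != finset.set0 by apply/set0Pn; exists m.
apply/andP/andP => -[].
  move=> /andP[pP /forall_inP cP] BP; rewrite finset.setD1K //; split=> //.
  rewrite /final_partition -BD partitionD1 //=.
  by apply/forall_inP => V /setD1P[_]; apply: cP.
move=> /eqP eP /andP[pP /forall_inP cP].
have BP : B \in P by rewrite -eP setU11.
split=> //; apply/andP; split.
  rewrite -eP -BU; apply: partitionU1 => //.
  by rewrite -setI_eq0; apply/eqP/setP => i; rewrite !inE; case: (leqP i k); rewrite ?andbF.
apply/forall_inP => V; rewrite -eP => /setU1P[->|]; last exact: cP.
apply/convex_setP => i j l; rewrite !inE => /andP[mi _] /andP[_ lk] /andP[ij jl].
by rewrite (leq_trans mi) ?(leq_trans jl).
Qed.

Lemma interval_set_notin (m k : 'I_n) P : (m <= k)%N -> final_partition k.+1 P ->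
  interval_set m k \notin P.
Proof.
move=> mk /andP[/and3P[/eqP cP _ _] _]; apply/negP => BP.
have : m \in finset.cover P by apply/finset.bigcupP; exists (interval_set m k); rewrite // inE leqnn.
by rewrite cP inE ltnNge mk.
Qed.

Variable K : comPzRingType.

(** Partitions are grouped by the end of their first block; deleting that block is a bijection onto
    the partitions of the remaining segment. *)
Lemma sum_final_partition (F : {set 'I_n} -> K) (m : 'I_n) :
  \sum_(P | final_partition m P) \prod_(V in P) F V =
  \sum_(k < n | (m <= k)%N)
     F (interval_set m k) *
     \sum_(P | final_partition k.+1 P) \prod_(V in P) F V.
Proof.
(* The default [m] is never reached on a final partition, by [final_partition_first]. *)
pose first P := odflt m [pick k : 'I_n | (m <= k)%N && (interval_set m k \in P)].
have firstP P : final_partition m P -> (m <= first P)%N && (interval_set m (first P) \in P).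
  move=> /final_partition_first[k mk kP]; rewrite /first.
  by case: pickP => [//|/(_ k)]; rewrite mk kP.
rewrite (partition_big first (fun k : 'I_n => (m <= k)%N)) /=; last first.
  by move=> P /firstP/andP[].
apply: eq_bigr => k mk; set B := interval_set m k; rewrite mulr_sumr.
rewrite (reindex_onto (fun P => B |: P) (fun P => P :\ B)) /=; last first.
  by move=> P /andP[/firstP/andP[_ BP] /eqP Pk]; rewrite finset.setD1K // /B -Pk.
have E P : (final_partition m (B |: P) && (first (B |: P) == k) && ((B |: P) :\ B == P)) =
           final_partition k.+1 P.
  have [DP|DP] := eqVneq ((B |: P) :\ B) P; last first.
    rewrite andbF; apply/esym/negbTE; apply: contra DP => kP.
    by rewrite setU1K // interval_set_notin.
  rewrite andbT; have := final_partition_cons (B |: P) mk.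
  rewrite -/B DP eqxx setU11 /= andbT => <-.
  apply/andP/idP => [[]//|mP]; split=> //; apply/eqP.
  have /andP[mf fP] := firstP _ mP.
  by apply: (final_partition_first_uniq mP) => //; rewrite setU11.
rewrite (eq_bigl _ _ E); apply: eq_bigr => P kP.
by rewrite big_setU1 // interval_set_notin.
Qed.

Lemma sum_final_partition_max (F : {set 'I_n} -> K) :
  \sum_(P | final_partition n P) \prod_(V in P) F V = 1.
Proof.
have D0 : final_segment n = finset.set0.
  by apply/setP => i; rewrite !inE leqNgt ltn_ord.
rewrite (big_pred1 (finset.set0 : {set {set 'I_n}})) ?big_set0 // => P.
rewrite /final_partition D0 partition_set0 /=; case: eqP => [->|//].
by apply/forall_inP => V; rewrite inE.
Qed.

End IntervalPartitions.

(** * The moment-cumulant formula as a recursion over first blocks *)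

Section MomentCumulant.
Variables (R : realType) (A : starNCPS R).

(** Positions are enumerated in increasing order, and a strictly increasing list is determined by
    its members. *)
Lemma subword_interval (a : seq A) (m k : nat) : (m <= k < size a)%N ->
  subword (interval_set (size a) m k) = take (k.+1 - m) (drop m a).
Proof.
move=> /andP[mk ka].
have -> : subword (interval_set (size a) m k) =
    [seq a`_i | i <- [seq val i | i <- enum (interval_set (size a) m k)]].
  by rewrite -map_comp.
have -> : [seq val i | i <- enum (interval_set (size a) m k)] = iota m (k.+1 - m).
  apply: (@irr_sorted_eq _ ltn); [exact: ltn_trans|exact: ltnn| | |].
  - apply: (@subseq_sorted _ _ ltn_trans _ (map val (enum 'I_(size a)))).
      by rewrite map_subseq // [X in subseq X]/enum_mem -enumT filter_subseq.
    by rewrite val_enum_ord iota_ltn_sorted.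
  - exact: iota_ltn_sorted.
  move=> i; rewrite mem_iota subnKC ?(leqW mk) //.
  apply/seq.mapP/idP => [[j]|/andP[mi ik]].
    by rewrite mem_enum inE => ? ->.
  have ia : (i < size a)%N by apply: leq_trans ik _.
  by exists (Ordinal ia); rewrite // mem_enum inE /= mi.
apply: (@eq_from_nth _ 0) => [|i].
  rewrite size_map size_iota size_takel // size_drop.
  by rewrite leq_sub2r.
rewrite size_map size_iota => ik.
by rewrite (nth_map 0%N) ?size_iota // nth_iota // nth_take // nth_drop.
Qed.

(** Downward induction on [m]: both sides satisfy the same first-block recursion and equal 1 at
    [m = size a]. *)
Lemma sum_final_partition_moment (f : seq A -> CC R) (a : seq A) (m : nat) :
  (m <= size a)%N ->
  \sum_(P | final_partition m P) \prod_(V in P) f (@subword R A a V) =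
  boolean_moment f (drop m a).
Proof.
have [d] := ubnP (size a - m)%N; elim: d m => // d IH m mad.
rewrite leq_eqVlt => /orP[/eqP ->|ma].
  by rewrite sum_final_partition_max drop_size.
rewrite (sum_final_partition _ (Ordinal ma)) /= boolean_momentE ?size_drop ?subn_gt0 //.
rewrite -(big_geq_mkord m (size a) xpredT (fun k => f (subword (interval_set (size a) m k)) *
   \sum_(P | final_partition k.+1 P) \prod_(V in P) f (@subword R A a V))).
rewrite -(big_mkord xpredT (fun k => f (take k.+1 (drop m a)) *
  boolean_moment f (drop k.+1 (drop m a)))).
(* Block ends are absolute positions on the left and relative to [m] on the right; the shift aligns
   them. *)
rewrite -{1}(add0n m) big_addn; apply: eq_big_nat => k /andP[_ km].
have kma : (k + m < size a)%N by rewrite addnC -ltn_subRL.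
rewrite subword_interval ?leq_addl // -addSn addnK IH ?drop_drop //.
by rewrite addSn subnS prednK ?subn_gt0 // (leq_trans _ (mad : (_ <= d)%N)) // leq_sub2l ?leq_addl.
Qed.

Lemma phi_boolean_moment (a : seq A) :
  phi (\prod_(x <- a) x) = boolean_moment (@bcumulant R A) a.
Proof.
case: a => [|x a]; first by rewrite big_nil phi1.
by rewrite moment_bcumulant // -[in RHS](drop0 (x :: a)) -sum_final_partition_moment.
Qed.

Lemma phi_word (x : A) (xi : seq bool) :
  phi (word star x xi) = boolean_moment (@bcumulant R A \o wletters star x) xi.
Proof. by rewrite [LHS]phi_boolean_moment boolean_moment_map. Qed.

End MomentCumulant.

(** * Moments of words in independent entries *)

Section ColouredWords.
Variables (K : comPzRingType) (E : Type) (C : eqType) (b : seq E -> K).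
Implicit Types (w : seq (E * C)).

(** These are the joint cumulants of a Boolean independent, identically distributed family indexed
    by [C]: mixed ones vanish, and all colours share [b]. *)
Definition coloured_cumulant w : K := b (unzip1 w) *+ constant (unzip2 w).

Let cm := boolean_moment coloured_cumulant.

Lemma coloured_cumulant_run (c : C) (s : seq E) :
  coloured_cumulant [seq (e, c) | e <- s] = b s.
Proof.
rewrite /coloured_cumulant /unzip1 /unzip2 -!map_comp map_id.
suff -> : constant [seq c | _ <- s] by [].
by case: s => //= _ s; elim: s => //= _ s ->; rewrite eqxx.
Qed.

(** A block of mixed colours stays mixed when extended, so every term has a vanishing factor. *)
Lemma coloured_moment_from0 pre s : ~~ constant (unzip2 pre) ->
  boolean_moment_from coloured_cumulant pre s = 0.
Proof.
elim: s pre => [|y s IH] pre Npre /=; rewrite /coloured_cumulant (negbTE Npre) //.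
rewrite mul0r addr0 IH //; apply: contra Npre.
by case: pre => //= p pre; rewrite /unzip2 map_rcons all_rcons => /andP[].
Qed.

(** No contributing block crosses a change of colour, so the sum over interval partitions factors
    there. *)
Lemma coloured_moment_run (c : C) (s : seq E) w :
  (if w is y :: _ then c != y.2 else true) ->
  cm ([seq (e, c) | e <- s] ++ w) = boolean_moment b s * cm w.
Proof.
move=> cw; case: s => [|e s]; first by rewrite mul1r.
rewrite /cm /= -[[:: (e, c)]]/([seq (e, c) | e <- [:: e]]).
have: (0 < size [:: e])%N by [].
elim: s [:: e] => [|e' s IH] pre pre0 /=.
  case: w cw => [_|y w cy] /=; first by rewrite mulr1 coloured_cumulant_run.
  rewrite coloured_cumulant_run coloured_moment_from0 ?add0r //.
  case: pre pre0 => //= p pre _.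
  by rewrite /unzip2 map_rcons all_rcons /= eq_sym (negbTE cy).
rewrite -map_rcons mulrDl -mulrA -IH.
  by rewrite coloured_cumulant_run -(IH [:: e']).
by rewrite size_rcons.
Qed.

Definition word_of_runs (rs : seq (C * seq E)) : seq (E * C) :=
  flatten [seq [seq (e, r.1) | e <- r.2] | r <- rs].

Definition proper_runs (rs : seq (C * seq E)) : bool :=
  sorted (fun r r' => r.1 != r'.1) rs && all (fun r => 0 < size r.2)%N rs.

Lemma runs_exist w : exists2 rs, proper_runs rs & w = word_of_runs rs.
Proof.
elim: w => [|[e c] w [rs rsP ->]]; first by exists [::].
case: rs rsP => [|[c' s] rs] rsP; first by exists [:: (c, [:: e])].
have [cc'|cc'] := eqVneq c c'.
  exists ((c', e :: s) :: rs); last by rewrite cc'.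
  by move: rsP => /andP[/= srs /andP[_ ars]]; rewrite /proper_runs /= ars andbT; case: rs srs ars.
exists ((c, [:: e]) :: (c', s) :: rs) => //.
by move: rsP; rewrite /proper_runs /= cc'.
Qed.

Lemma coloured_moment_runs rs : proper_runs rs ->
  cm (word_of_runs rs) = \prod_(r <- rs) boolean_moment b r.2.
Proof.
elim: rs => [|[c s] rs IH]; first by rewrite big_nil.
rewrite big_cons => /andP[/= srs /andP[_ ars]].
rewrite -IH; last by rewrite /proper_runs ars (path_sorted srs).
apply: coloured_moment_run.
by case: rs srs ars {IH} => [|[c' [|e s']] rs] //= /andP[].
Qed.

End ColouredWords.

(** * Mixed moments of Boolean independent variables *)

Section IndependentWords.
Variables (R : realType) (A : starNCPS R) (C : finType) (x : C -> A).
Variable b : seq bool -> CC R.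
Hypothesis x_moment : forall c xi, phi (word star (x c) xi) = boolean_moment b xi.
Hypothesis x_independent : boolean_independent_variables x.

Definition letter (l : bool * C) : A := if l.1 then star (x l.2) else x l.2.

Lemma smallest_word (c : C) (xi : seq bool) : (0 < size xi)%N ->
  smallest (@nonunital_star_subalgebra R A) [set x c] (word star (x c) xi).
Proof.
move=> xi0 S [[_ _ _ SM Sstar] xS].
have Sx : S (x c) by apply: xS.
case: xi xi0 => // e xi _; rewrite /word /=; elim: xi e => [|e' xi IH] e.
  by rewrite big_seq1; case: e => //; apply: Sstar.
by rewrite big_cons; apply: SM (IH e'); case: e => //; apply: Sstar.
Qed.

(** Both sides factor over the maximal runs of one colour: the left by Boolean independence, the
    right by the vanishing of mixed cumulants. *)
Lemma phi_letters (w : seq (bool * C)) :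
  phi (\prod_(l <- w) letter l) = boolean_moment (coloured_cumulant b) w.
Proof.
have [rs rsP ->] := runs_exist w; rewrite coloured_moment_runs //.
have -> : \prod_(l <- word_of_runs rs) letter l =
    \prod_(r <- rs) word star (x r.1) r.2.
  rewrite /word_of_runs big_flatten big_map; apply: eq_bigr => r _.
  by rewrite /word /wletters !big_map.
case: rs rsP => [|r0 rs] rsP; first by rewrite !big_nil phi1.
rewrite !(big_nth r0) !big_mkord.
have := x_independent (m := size (r0 :: rs)) (i := fun k => (nth r0 (r0 :: rs) k).1)
  (a := fun k => word star (x (nth r0 (r0 :: rs) k).1) (nth r0 (r0 :: rs) k).2).
move: rsP => /andP[srs /allP ars] ->; first by apply: eq_bigr => k _; apply: x_moment.
- by [].
- by move=> k ks; apply: smallest_word; apply: (ars _ (mem_nth _ ks)).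
- by move=> k ks; apply/eqP; move/sortedP: srs; apply.
Qed.

End IndependentWords.

(** * Words in a random matrix *)

Section PathSums.
Variables (K : comPzRingType) (N : nat).
Implicit Types (xi : seq bool) (i j l : 'I_N) (c : 'I_N * 'I_N).
Implicit Types (F G : seq (bool * ('I_N * 'I_N)) -> K).

(** The adjoint transposes: its entry at [(i, j)] comes from position [(j, i)] of X. *)
Definition entry_of_step (e : bool) i j : 'I_N * 'I_N := if e then (j, i) else (i, j).

Definition step_target (e : bool) c : 'I_N := if e then c.1 else c.2.

(* The sum of [F] over the words obtained by expanding the [(i, j)] entry of the
   product of matrices X^{xi_1} ... X^{xi_n}: each letter is recorded together
   with the position in X of the entry that it comes from. *)
Fixpoint path_sum xi F i j : K :=
  if xi is e :: xi' then
    \sum_l path_sum xi' (fun w => F ((e, entry_of_step e i l) :: w)) l j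
  else F [::] *+ (i == j).

Lemma eq_path_sum xi F G i j : (forall w, unzip1 w = xi -> F w = G w) ->
  path_sum xi F i j = path_sum xi G i j.
Proof.
elim: xi F G i => [|e xi IH] F G i FG /=; first by rewrite FG.
by apply: eq_bigr => l _; apply: IH => w wxi; rewrite FG //= wxi.
Qed.

Lemma path_sum_sum (I : finType) xi (F : I -> seq (bool * ('I_N * 'I_N)) -> K) i j :
  path_sum xi (fun w => \sum_k F k w) i j = \sum_k path_sum xi (F k) i j.
Proof.
elim: xi F i => [|e xi IH] F i /=; first by rewrite sumrMnl.
by rewrite exchange_big; apply: eq_bigr => l _; apply: IH.
Qed.

Lemma path_sumZ xi (a : K) F i j :
  path_sum xi (fun w => a * F w) i j = a * path_sum xi F i j.
Proof.
elim: xi F i => [|e xi IH] F i /=; first by rewrite mulrnAr.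
by rewrite mulr_sumr; apply: eq_bigr => l _; apply: IH.
Qed.

Lemma path_sum_cat xi1 xi2 F i j :
  path_sum (xi1 ++ xi2) F i j =
  \sum_l path_sum xi1 (fun w1 => path_sum xi2 (fun w2 => F (w1 ++ w2)) l j) i l.
Proof.
elim: xi1 F i => [|e xi1 IH] F i /=.
  rewrite (bigD1 i) //= eqxx big1 ?addr0 // => l li.
  by rewrite eq_sym (negbTE li).
by rewrite exchange_big; apply: eq_bigr => l _; rewrite IH.
Qed.

(** For nonempty [xi], entry [(i, j)] counts the paths from [i] to [j] whose letters all come from
    one position of X; see [path_sum_constant]. *)
Definition run_matrix xi : 'M[K]_N :=
  if sorted (fun e f => e != f) xi
  then if odd (size xi) then const_mx 1 else N%:R%:M else 1%:M.

Lemma entry_of_step_eq (e e' : bool) c l :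
  (entry_of_step e' (step_target e c) l == c) =
  ((e != e') || (c.1 == c.2)) && (l == step_target e' c).
Proof.
by case: c => p q; case: e e' => -[]; rewrite /= xpair_eqE ?eqxx ?andbT ?(eq_sym q p) //= andbC.
Qed.

(** Staying at position [c] leaves at most one choice per step, available exactly when the exponent
    changes or [c] is diagonal. The last exponent then fixes the endpoint. *)
Lemma path_sum_repeat xi (e : bool) c j :
  path_sum xi (fun w => (all (pred1 c) (unzip2 w))%:R) (step_target e c) j =
  ((path (fun e f => e != f) e xi || (c.1 == c.2)) &&
   (step_target (last e xi) c == j))%:R.
Proof.
elim: xi e => [|e' xi IH] e //=.
have E l : path_sum xi (fun w => ((entry_of_step e' (step_target e c) l == c) &&
    all (pred1 c) (unzip2 w))%:R) l j =
    (entry_of_step e' (step_target e c) l == c)%:R *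
    path_sum xi (fun w => (all (pred1 c) (unzip2 w))%:R) l j.
  by rewrite -path_sumZ; apply: eq_path_sum => w _; rewrite -natrM mulnb.
rewrite (eq_bigr _ (fun l _ => E l)) (bigD1 (step_target e' c)) //= big1 ?addr0.
  by rewrite entry_of_step_eq eqxx andbT IH -natrM mulnb andbA orb_andl.
by move=> l lc; rewrite entry_of_step_eq (negbTE lc) andbF mul0r.
Qed.

Lemma last_alternating (e : bool) xi : path (fun e f => e != f) e xi ->
  last e xi = odd (size xi) (+) e.
Proof.
elim: xi e => [|f xi IH] e //= /andP[ef /IH ->].
by case: e f ef => -[] //; case: odd.
Qed.

Lemma path_sum_constant xi i j : (0 < size xi)%N ->
  path_sum xi (fun w => (constant (unzip2 w))%:R) i j = run_matrix xi i j.
Proof.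
case: xi => // e xi _ /=.
have E l : path_sum xi (fun w => (all (pred1 (entry_of_step e i l)) (unzip2 w))%:R) l j =
    ((path (fun e f => e != f) e xi || (i == l)) &&
     (step_target (last e xi) (entry_of_step e i l) == j))%:R.
  have el : l = step_target e (entry_of_step e i l) by case: e.
  by rewrite {2}el path_sum_repeat; case: (e) => /=; rewrite // (eq_sym l).
rewrite (eq_bigr _ (fun l _ => E l)) /run_matrix /=.
(* Without alternation only the diagonal position at [i] can repeat. *)
case: ifP => [exi|_] /=; last first.
  rewrite (bigD1 i) //= eqxx big1 ?addr0 => [|l li]; last by rewrite eq_sym (negbTE li).
  by rewrite mxE; congr (_ == j)%:R; case: (last e xi); case: (e).
(* Here [xi] lacks the first letter, so its parity is opposite to that of the word. A word of even
   length returns to [i] after any of the N first steps; one of odd length must step to [j] at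
   once. *)
rewrite (last_alternating exi); case: (odd (size xi)) => /=.
  rewrite mxE (eq_bigr (fun _ => (i == j)%:R)) => [|l _]; last by case: (e).
  by rewrite sumr_const card_ord -mulrnA mulnC mulrnA.
rewrite mxE (bigD1 j) //= big1 ?addr0 => [|l lj].
  by case: (e); rewrite /= eqxx.
by case: (e); rewrite /= (negbTE lj).
Qed.

(** Each path is cut at the end of the first block: constancy of the colour there yields
    [run_matrix], and the rest of the path is free. *)
Lemma path_sum_coloured_moment (b : seq bool -> K) xi i j : (0 < size xi)%N ->
  let bm := boolean_moment (coloured_cumulant b) in
  path_sum xi bm i j =
  \sum_(k < size xi) b (take k.+1 xi) *
    \sum_l run_matrix (take k.+1 xi) i l * path_sum (drop k.+1 xi) bm l j.
Proof.
move=> xi0 bm.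
rewrite (@eq_path_sum _ _ (fun w => \sum_(k < size xi)
    coloured_cumulant b (take k.+1 w) * bm (drop k.+1 w))); last first.
  move=> w /(congr1 size); rewrite size_map => wxi.
  by rewrite /bm boolean_momentE wxi.
rewrite path_sum_sum; apply: eq_bigr => k _.
have sk : size (take k.+1 xi) = k.+1 by rewrite size_takel.
rewrite -{1}(cat_take_drop k.+1 xi) path_sum_cat mulr_sumr.
apply: eq_bigr => l _; rewrite -path_sum_constant ?sk // mulrA.
rewrite mulrC -[b _ * _]path_sumZ -path_sumZ.
apply: eq_path_sum => w1 w1xi.
have sw1 : size w1 = k.+1 by rewrite -sk -w1xi size_map.
rewrite [RHS]mulrC -path_sumZ; apply: eq_path_sum => w2 _.
by rewrite take_size_cat // drop_size_cat // /coloured_cumulant w1xi mulr_natr.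
Qed.

End PathSums.

(** * The recursion for the matrix of moments *)

Section MatrixWords.
Variables (R : realType) (A : starNCPS R) (N : nat) (x : 'I_N -> 'I_N -> A).
Let X : 'M[A]_N := \matrix_(i, j) x i j.
Let lett := letter (fun p : 'I_N * 'I_N => x p.1 p.2).

(** The factor [a] collects the letters already expanded; the induction needs it because [phi] is
    not multiplicative. *)
Lemma phi_mul_matrix_word (a : A) (xi : seq bool) (i j : 'I_N) :
  phi (a * (word (@mxstar R A N) X xi) i j) =
  path_sum xi (fun w => phi (a * \prod_(l <- w) lett l)) i j.
Proof.
elim: xi a i => [|e xi IH] a i /=.
  rewrite /word /= !big_nil !mulr1 mxE.
  by case: (i == j); rewrite ?mulr1 // mulr0 linear0.
have -> : word (@mxstar R A N) X (e :: xi) =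
    (if e then mxstar X else X) *m word (@mxstar R A N) X xi.
  by rewrite /word /= big_cons.
rewrite mxE mulr_sumr linear_sum; apply: eq_bigr => l _.
rewrite mulrA IH; apply: eq_path_sum => w _.
rewrite big_cons -mulrA; congr (phi (_ * (_ * _))).
by case: e; rewrite /lett /letter !mxE.
Qed.

Variable b : seq bool -> CC R.
Hypothesis x_moment : forall i j xi, phi (word star (x i j) xi) = boolean_moment b xi.
Hypothesis x_independent :
  boolean_independent_variables (fun p : 'I_N * 'I_N => x p.1 p.2).

Lemma phi_matrix_word (xi : seq bool) (i j : 'I_N) :
  phi (word (@mxstar R A N) X xi i j) =
  path_sum xi (boolean_moment (coloured_cumulant b)) i j.
Proof.
rewrite -[X in phi X]mul1r phi_mul_matrix_word.
apply: eq_path_sum => w _; rewrite mul1r.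
by apply: phi_letters => // c eta; apply: x_moment.
Qed.

Lemma phi_matrix_word_rec (xi : seq bool) : (0 < size xi)%N ->
  map_mx phi (word (@mxstar R A N) X xi) =
  \sum_(k < size xi) b (take k.+1 xi) *:
    (run_matrix _ N (take k.+1 xi) *m
     map_mx phi (word (@mxstar R A N) X (drop k.+1 xi))).
Proof.
move=> xi0; apply/matrixP => i j; rewrite mxE phi_matrix_word.
rewrite path_sum_coloured_moment // summxE; apply: eq_bigr => k _.
rewrite !mxE; congr (_ * _); apply: eq_bigr => l _.
by rewrite mxE phi_matrix_word.
Qed.

End MatrixWords.

(** * Asymptotics *)

Section SmallSequences.
Variable R : realType.
Implicit Types (u v : nat -> CC R).

Definition small u : Prop := forall eps : R, eps < 1 ->
  (fun N : nat => (N%:R `^ eps)%:C%C * u N : CC R) @ \oo --> (0 : CC R).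

Lemma cvg0M u v (l : CC R) : u @ \oo --> (0 : CC R) -> v @ \oo --> l ->
  (fun N => u N * v N : CC R) @ \oo --> (0 : CC R).
Proof. by move=> u0 vl; have := cvgM u0 vl; rewrite mul0r; apply. Qed.

Lemma small0 : small (fun=> 0).
Proof. by move=> eps _; under eq_fun do rewrite mulr0; apply: cvg_cst. Qed.

Lemma small_cvg0 u : small u -> u @ \oo --> (0 : CC R).
Proof. by move=> /(_ 0 ltr01); under eq_fun do rewrite powRr0 mul1r. Qed.

Lemma smallD u v : small u -> small v -> small (fun N => u N + v N).
Proof.
move=> su sv eps e1; under eq_fun do rewrite mulrDr.
by rewrite -(addr0 0); apply: cvgD; [apply: su|apply: sv].
Qed.

Lemma smallN u : small u -> small (fun N => - u N).
Proof.
move=> su eps e1; under eq_fun do rewrite mulrN.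
by rewrite -oppr0; apply: cvgN; apply: su.
Qed.

Lemma small_sum n (u : 'I_n -> nat -> CC R) :
  (forall k, small (u k)) -> small (fun N => \sum_(k < n) u k N).
Proof.
elim: n u => [|n IH] u su; first by under eq_fun do rewrite big_ord0; apply: small0.
by under eq_fun do rewrite big_ord_recr; apply: smallD => //; apply: IH.
Qed.

Lemma smallM_cvg u v (l : CC R) : small u -> v @ \oo --> l ->
  small (fun N => u N * v N).
Proof.
move=> su vl eps e1; under eq_fun do rewrite mulrA.
exact: (cvg0M (su eps e1) vl).
Qed.

(** The weight N^(eps + 1) is split evenly: each sequence absorbs N^d with d = (eps + 1)/2, which is
    still below 1. *)
Lemma small_natM u v : small u -> small v -> small (fun N => N%:R * (u N * v N)).
Proof.
move=> su sv eps e1; pose d := (eps + 1) / 2.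
have dd : d + d = eps + 1 by rewrite /d -splitr.
have d1 : d < 1 by rewrite ltr_pdivrMr // mul1r ltrD2r.
have : (fun N : nat => ((N%:R `^ d)%:C%C * u N) * ((N%:R `^ d)%:C%C * v N) : CC R)
    @ \oo --> (0 : CC R).
  exact: (cvg0M (su d d1) (sv d d1)).
apply: cvg_trans; apply: near_eq_cvg; near=> N.
have N0 : (0 < N)%N by near: N; apply: nbhs_infty_gt.
rewrite mulrACA -rmorphM -powRD; last by rewrite pnatr_eq0 -lt0n N0 implybT.
rewrite dd powRD; last by rewrite pnatr_eq0 -lt0n N0 implybT.
by rewrite powRr1 ?ler0n // rmorphM /= rmorph_nat -mulrA.
Unshelve. all: by end_near. Qed.

(** In the form t I + s J, with J the all-ones matrix, [t] carries the limit; asking [s] to be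
    small, not merely null, absorbs the factors N arising in products. *)
Definition scalar_plus_small (u : forall N, 'M[CC R]_N) (l : CC R) : Prop :=
  exists t s, [/\ forall N, u N = (t N)%:M + const_mx (s N), t @ \oo --> l & small s].

Lemma scalar_plus_small_sum n (u : 'I_n -> forall N, 'M[CC R]_N) (l : 'I_n -> CC R) :
  (forall k, scalar_plus_small (u k) (l k)) ->
  scalar_plus_small (fun N => \sum_(k < n) u k N) (\sum_(k < n) l k).
Proof.
elim: n u l => [|n IH] u l ul.
  rewrite big_ord0; exists (fun=> 0), (fun=> 0); split; [|exact: cvg_cst|exact: small0].
  by move=> N; rewrite big_ord0 !raddf0 addr0.
have [t [s [uE tl ss]]] := IH _ _ (fun k => ul (widen_ord (leqnSn n) k)).
have [t' [s' [uE' tl' ss']]] := ul ord_max.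
exists (fun N => t N + t' N), (fun N => s N + s' N); split.
- by move=> N; rewrite big_ord_recr /= uE uE' !raddfD addrACA.
- by rewrite big_ord_recr; exact: (cvgD tl tl').
- exact: smallD.
Qed.

(** For I, the factor [b] sends the scalar part to 0; for N I, it is multiplied by N b, which tends
    to [k]; for J, the identity J (t I + s J) = (t + N s) J leaves no scalar part. *)
Lemma scalar_plus_small_run (b : nat -> CC R) (k l : CC R) xi
    (u : forall N, 'M[CC R]_N) :
  small b ->
  (if Defs.alternating xi then (fun N => N%:R * b N : CC R) @ \oo --> k else k = 0) ->
  scalar_plus_small u l ->
  scalar_plus_small (fun N => b N *: (run_matrix _ N xi *m u N)) (k * l).
Proof.
move=> sb bk [t [s [uE tl ss]]]; rewrite /Defs.alternating /run_matrix in bk *.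
case: (sorted _ xi) bk => bk; last first.
  rewrite andbF in bk; exists (fun N => b N * t N), (fun N => b N * s N); split.
  - by move=> N; rewrite mul1mx uE scalerDr scale_scalar_mx scalemx_const.
  - rewrite bk mul0r; exact: (cvg0M (small_cvg0 sb) tl).
  - exact: (smallM_cvg sb (small_cvg0 ss)).
rewrite andbT in bk; case: (odd (size xi)) bk => /= bk; last first.
  exists (fun N => N%:R * b N * t N), (fun N => N%:R * (b N * s N)); split.
  - move=> N; rewrite mul_scalar_mx uE scalerA scalerDr scale_scalar_mx scalemx_const.
    by rewrite mulrA (mulrC (b N)).
  - exact: (cvgM bk tl).
  - exact: (small_natM sb ss).
exists (fun=> 0), (fun N => b N * t N + N%:R * (b N * s N)); split.
- move=> N; rewrite uE mulmxDr mul_mx_scalar scalerDr raddf0 add0r raddfD.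
  congr (_ + _); first by rewrite scalemx_const scalemx_const mulr1.
  apply/matrixP => i j; rewrite !mxE (eq_bigr (fun=> s N)); last first.
    by move=> m _; rewrite !mxE mul1r.
  by rewrite sumr_const card_ord mulrnAr mulr_natl.
- by rewrite bk mul0r; apply: cvg_cst.
- exact: (smallD (smallM_cvg sb tl) (small_natM sb ss)).
Qed.

Lemma scalar_plus_small_trace (u : forall N, 'M[CC R]_N) (l : CC R) :
  scalar_plus_small u l -> (fun N => N%:R^-1 * \tr (u N) : CC R) @ \oo --> l.
Proof.
move=> [t [s [uE tl ss]]]; rewrite -(addr0 l).
apply: cvg_trans (cvgD tl (small_cvg0 ss)); apply: near_eq_cvg; near=> N.
have N0 : (0 < N)%N by near: N; apply: nbhs_infty_gt.
rewrite uE /mxtrace (eq_bigr (fun=> t N + s N)); last first.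
  by move=> i _; rewrite !mxE eqxx.
by rewrite sumr_const card_ord -[(_ + _) *+ _]mulr_natl mulKf // pnatr_eq0 -lt0n.
Unshelve. all: by end_near. Qed.

(** * From small moments to small cumulants *)

Section Cumulants.
Variables (m b : nat -> seq bool -> CC R).
Hypothesis mb : forall N xi, m N xi = boolean_moment (b N) xi.
Hypothesis small_m : forall xi, (0 < size xi)%N -> small (m ^~ xi).

Lemma cumulant_moment N y xi : b N (y :: xi) =
  m N (y :: xi) - \sum_(k < size xi) b N (y :: take k xi) * m N (drop k xi).
Proof.
rewrite mb boolean_momentE //= big_ord_recr /= take_size drop_size mulr1.
rewrite (eq_bigr (fun k : 'I_(size xi) => b N (y :: take k xi) * m N (drop k xi))).
  by rewrite [X in X - _]addrC addrK.
by move=> k _; rewrite mb.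
Qed.

(** Induction on the length: the corrections in [cumulant_moment] are products of a small shorter
    cumulant and a moment tending to 0. *)
Lemma small_cumulant xi : (0 < size xi)%N -> small (b ^~ xi).
Proof.
have [n] := ubnP (size xi); elim: n xi => // n IH [|y xi] //= xin _.
under eq_fun do rewrite cumulant_moment.
apply: smallD; first exact: small_m.
apply: smallN; apply: small_sum => k; apply: smallM_cvg.
  by apply: IH => //=; rewrite size_takel ?(ltnW (ltn_ord k)) // (leq_ltn_trans (ltn_ord k)).
by apply: small_cvg0; apply: small_m; rewrite size_drop subn_gt0.
Qed.

(** The corrections are N times products of two small sequences, so they vanish in the limit. *)
Lemma cvg_natM_cumulant xi (l : CC R) : (0 < size xi)%N ->
  (fun N => N%:R * m N xi : CC R) @ \oo --> l ->
  (fun N => N%:R * b N xi : CC R) @ \oo --> l.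
Proof.
case: xi => // y xi _ ml; under eq_fun do rewrite cumulant_moment mulrBr.
rewrite -(subr0 l); apply: (cvgB ml); apply: small_cvg0.
under eq_fun do rewrite mulr_sumr.
apply: small_sum => k; apply: small_natM; first exact: small_cumulant.
by apply: small_m; rewrite size_drop subn_gt0.
Qed.

End Cumulants.

End SmallSequences.

(** This form turns alternating words into powers of [x * star x] or [star x * x], as in the
    hypotheses on the limits. *)
Lemma alternatingE xi : Defs.alternating xi ->
  xi = flatten (nseq (size xi)./2 [:: head false xi; ~~ head false xi]).
Proof.
have [n] := ubnP (size xi); elim: n xi => // n IH [|e [|f xi]] //= xin /andP[].
rewrite /= negbK => oxi /andP[ef pxi].
have -> : f = ~~ e by case: e f ef {pxi} => -[].
congr [:: _, _ & _].
have axi : Defs.alternating xi by rewrite /Defs.alternating oxi (path_sorted pxi).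
rewrite {1}(IH xi _ axi); last exact: ltnW.
case: xi {xin axi oxi} pxi => //= g xi /andP[fg _].
by have -> : g = e by case: e f g ef fg => -[] [].
Qed.

Definition limit_cumulant (K : nzRingType) (alpha beta : nat -> K) (xi : seq bool) : K :=
  if Defs.alternating xi
  then (if head false xi then beta else alpha) (size xi)./2 else 0.

(** * Asymptotics of the matrix of moments *)

Section RandomMatrix.
Variables (R : realType) (A : starNCPS R) (x : nat -> nat -> nat -> A).
Variables (alpha beta : nat -> CC R).
Hypothesis x_identically_distributed : forall N i j k l : nat,
  (i < N)%N -> (j < N)%N -> (k < N)%N -> (l < N)%N ->
  identically_distributed (x N i j) (x N k l).
Hypothesis x_independent : forall N : nat,
  boolean_independent_variables (fun p : 'I_N * 'I_N => x N p.1 p.2).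
Hypothesis lim_alpha : forall m : nat, (0 < m)%N ->
  (fun N : nat => N%:R * phi ((x N 0 0 * star (x N 0 0)) ^+ m) : CC R)
    @ \oo --> alpha m.
Hypothesis lim_beta : forall m : nat, (0 < m)%N ->
  (fun N : nat => N%:R * phi ((star (x N 0 0) * x N 0 0) ^+ m) : CC R)
    @ \oo --> beta m.
Hypothesis small_moment : forall xi : seq bool, (0 < size xi)%N ->
  small (fun N => phi (word star (x N 0 0) xi)).

Let b N := @bcumulant R A \o wletters star (x N 0 0).

Lemma lim_entry_cumulant xi : (0 < size xi)%N -> Defs.alternating xi ->
  (fun N => N%:R * b N xi : CC R) @ \oo --> limit_cumulant alpha beta xi.
Proof.
move=> xi0 axi; rewrite /limit_cumulant axi.
apply: (@cvg_natM_cumulant _ (fun N => @phi R A \o word star (x N 0 0))) => //=.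
  by move=> N eta; apply: phi_word.
have m0 : (0 < (size xi)./2)%N.
  by move: axi xi0 => /andP[+ _]; case: (xi) => [|? []].
have word_pow N (e : bool) m : word star (x N 0 0) (flatten (nseq m [:: e; ~~ e])) =
    (if e then star (x N 0 0) * x N 0 0 else x N 0 0 * star (x N 0 0)) ^+ m.
  elim: m => [|m IH]; first by rewrite /word big_nil expr0.
  by rewrite exprS -IH /word /= !big_cons mulrA; case: (e).
rewrite (alternatingE axi); under eq_fun do rewrite word_pow.
rewrite -(alternatingE axi).
by case: (head _ _); [apply: lim_beta|apply: lim_alpha].
Qed.

(** Strong induction on the length: each summand of the recursion is covered by
    [scalar_plus_small_run]. *)
Lemma phi_matrix_word_asymptotic xi :
  scalar_plus_small
    (fun N => map_mx phi (word (@mxstar R A N) (\matrix_(i < N, j < N) x N i j) xi))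
    (boolean_moment (limit_cumulant alpha beta) xi).
Proof.
have [n] := ubnP (size xi); elim: n xi => // n IH xi xin.
have [->|xi0] := eqVneq xi [::].
  exists (fun=> 1), (fun=> 0); split; [|exact: cvg_cst|exact: small0].
  move=> N; rewrite /word big_nil raddf0 addr0; apply/matrixP => i j; rewrite !mxE.
  by case: (i == j); rewrite ?phi1 ?linear0.
have s0 : (0 < size xi)%N by rewrite lt0n size_eq0.
rewrite boolean_momentE //.
have rec N : map_mx phi (word (@mxstar R A N) (\matrix_(i < N, j < N) x N i j) xi) =
    \sum_(k < size xi) b N (take k.+1 xi) *:
      (run_matrix _ N (take k.+1 xi) *m
       map_mx phi (word (@mxstar R A N) (\matrix_(i < N, j < N) x N i j) (drop k.+1 xi))).
  (* The cumulants are those of entry (0, 0), whose moments all entries share; it is in range since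
     [i < N] forces [0 < N]. *)
  apply: phi_matrix_word_rec => // i j eta; rewrite -phi_word.
  case: eta => [|e eta] //; apply: x_identically_distributed => //.
  exact: leq_ltn_trans (ltn_ord i).
  exact: leq_ltn_trans (ltn_ord i).
have := @scalar_plus_small_sum R (size xi) _ _ (fun k => @scalar_plus_small_run R
  (fun N => b N (take k.+1 xi)) (limit_cumulant alpha beta (take k.+1 xi))
  (boolean_moment (limit_cumulant alpha beta) (drop k.+1 xi)) (take k.+1 xi) _ _ _ (IH (drop k.+1 xi) _)).
case=> [k|k|k|t [s [uE tl ss]]].
- apply: (@small_cumulant _ (fun N => @phi R A \o word star (x N 0 0))) => //=.
    by move=> N eta; apply: phi_word.
  by rewrite size_takel.
- case: ifP => [ak|Nak]; last by rewrite /limit_cumulant Nak.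
  by apply: lim_entry_cumulant; rewrite ?size_takel.
- by rewrite size_drop (leq_trans _ (xin : (_ <= n)%N)) // ltn_subrL s0.
by exists t, s; split => // N; rewrite rec uE.
Qed.

End RandomMatrix.

(** * The limit distribution *)

Lemma alternating_flatten (e : bool) n :
  Defs.alternating (flatten (nseq n [:: e; ~~ e])).
Proof.
apply/andP; split.
  by rewrite size_flatten /shape map_nseq sumn_nseq oddM /= ?andbF ?andFb.
by case: e; elim: n => [|[|n] IH] //=; move: IH => /= ->.
Qed.

(* Linear extension from words is carried out over an abstract algebra [L], because
   unification with the concrete operations of [monalg.malg] can take minutes. *)
Section SpannedByWords.
Variables (K : comNzRingType) (L : lalgType K) (mon : K -> seq bool -> L).
Hypothesis mon_ind : forall P : L -> Prop,
  P 0 -> (forall g h, P g -> P h -> P (g + h)) -> (forall c s, P (mon c s)) ->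
  forall g, P g.
Hypothesis monM : forall c d s t, mon c s * mon d t = mon (c * d) (s ++ t).
Hypothesis monZ : forall c d s, c *: mon d s = mon (c * d) s.

(** Both sides are additive in [g] and in [h], so monomials suffice; there it is commutativity of
    [K]. *)
Lemma spanned_scalerAr (c : K) (g h : L) : c *: (g * h) = g * (c *: h).
Proof.
elim/mon_ind: g => [|g1 g2 IH1 IH2|d s]; first by rewrite !mul0r scaler0.
  by rewrite !mulrDl scalerDr IH1 IH2.
elim/mon_ind: h => [|h1 h2 IH1 IH2|d' s']; first by rewrite scaler0 !mulr0 scaler0.
  by rewrite !(mulrDr, scalerDr) IH1 IH2.
by rewrite monM !monZ monM mulrCA.
Qed.

Section Star.
Variables (conj : {rmorphism K -> K}) (st : L -> L).
Hypothesis st0 : st 0 = 0.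
Hypothesis stD : forall g h, st (g + h) = st g + st h.
Hypothesis st_mon : forall c s, st (mon c s) = mon (conj c) (rev (map negb s)).

Lemma spanned_starZ (c : K) (g : L) : st (c *: g) = conj c *: st g.
Proof.
elim/mon_ind: g => [|g h IHg IHh|d s].
- by rewrite scaler0 st0 scaler0.
- by rewrite scalerDr !stD IHg IHh scalerDr.
- by rewrite monZ !st_mon monZ rmorphM.
Qed.

Lemma spanned_starM (g h : L) : st (g * h) = st h * st g.
Proof.
elim/mon_ind: g => [|g1 g2 IH1 IH2|c s].
- by rewrite mul0r st0 mulr0.
- by rewrite mulrDl !stD IH1 IH2 mulrDr.
elim/mon_ind: h => [|h1 h2 IH1 IH2|d t].
- by rewrite mulr0 st0 mul0r.
- by rewrite mulrDr !stD IH1 IH2 mulrDl.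
by rewrite monM !st_mon monM map_cat rev_cat rmorphM mulrC.
Qed.

Lemma spanned_starK : involutive conj -> involutive st.
Proof.
move=> conjK g; elim/mon_ind: g => [|g h IHg IHh|c s].
- by rewrite !st0.
- by rewrite !stD IHg IHh.
rewrite !st_mon conjK map_rev revK -map_comp map_id_in // => e _ /=.
exact: negbK.
Qed.

End Star.

Lemma spanned_linear (psi : L -> K) (f : seq bool -> K) :
  psi 0 = 0 -> (forall g h, psi (g + h) = psi g + psi h) ->
  (forall c s, psi (mon c s) = c * f s) -> linear_for *%R psi.
Proof.
move=> psi0 psiD psi_mon c g h; rewrite psiD; congr (_ + _).
elim/mon_ind: g => [|g1 g2 IH1 IH2|d s].
- by rewrite scaler0 psi0 mulr0.
- by rewrite scalerDr !psiD IH1 IH2 mulrDr.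
- by rewrite monZ !psi_mon mulrA.
Qed.

End SpannedByWords.

(** * The free algebra on two letters *)

Section WordAlgebra.
Variable K : comNzRingType.

(* [monalg] gives [monalg.malg] an algebra structure for commutative monomials
   only, and a second instance on the same constant would be ignored. *)
Definition word_algebra : Type := monalg.malg (monalg.fmonom bool) K.
HB.instance Definition _ :=
  GRing.Lalgebra.copy word_algebra (monalg.malg (monalg.fmonom bool) K).

Definition monom (c : K) (s : seq bool) : word_algebra :=
  monalg.mkmalgU (monalg.FMonom s) c.

Lemma monomM c d s t : monom c s * monom d t = monom (c * d) (s ++ t).
Proof.
rewrite monalg.malgM_def /monom monalg.fgmulUU; congr (monalg.mkmalgU _ _).
exact: monalg.fmmulE.
Qed.

Lemma monomZ c d s : c *: monom d s = monom (c * d) s.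
Proof.
apply/monalg.malgP => k; rewrite monalg.mcoeffZ [in LHS]monalg.mcoeffU.
by rewrite [RHS]monalg.mcoeffU mulrnAr.
Qed.

Lemma monom1 : monom 1 [::] = 1.
Proof. by rewrite /monom -monalg.fmoneE. Qed.

Lemma monom_ind (P : word_algebra -> Prop) : P 0 -> (forall g h, P g -> P h -> P (g + h)) ->
  (forall c s, P (monom c s)) -> forall g, P g.
Proof.
move=> P0 PD PU g; rewrite (monalg.monalgE g).
by elim/big_ind: _ => // k _; rewrite -(monalg.fmK k); apply: PU.
Qed.

HB.instance Definition _ := GRing.Lalgebra_isAlgebra.Build K word_algebra
  (spanned_scalerAr monom_ind monomM monomZ).

End WordAlgebra.

(** * The space realizing prescribed Boolean cumulants *)

Section WordSpace.
Variables (R : realType) (kappa : seq bool -> CC R).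
Local Notation B := (word_algebra (CC R)).
Implicit Types (g h : B) (c : CC R) (s : seq bool).

(** Letter [false] stands for the generator and [true] for its adjoint, so words are reversed with
    letters exchanged, and coefficients are conjugated. *)
Definition word_star g : B :=
  monalg.mmap (fun c => monom c^* [::])
    (fun k : monalg.fmonom bool => monom 1 (rev (map negb k))) g.

Definition word_functional g : CC R :=
  monalg.mmap idfun (fun k : monalg.fmonom bool => boolean_moment kappa k) g.

Lemma word_starD g h : word_star (g + h) = word_star g + word_star h.
Proof. exact: (@monalg.mmapD _ _ _ (monalg.mkmalgU _ \o Num.conj)). Qed.

Lemma word_star0 : word_star 0 = 0.
Proof. exact: (@monalg.mmap0 _ _ _ (monalg.mkmalgU _ \o Num.conj)). Qed.

Lemma word_star_monom c s : word_star (monom c s) = monom c^* (rev (map negb s)).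
Proof.
rewrite /word_star (@monalg.mmapU _ _ _ (monalg.mkmalgU _ \o Num.conj)) /=.
by rewrite monomM mulr1.
Qed.

Lemma word_starZ c g : word_star (c *: g) = c^* *: word_star g.
Proof.
exact: (spanned_starZ (@monom_ind _) (@monomZ _) word_star0 word_starD word_star_monom).
Qed.

Lemma word_starM g h : word_star (g * h) = word_star h * word_star g.
Proof.
exact: (spanned_starM (@monom_ind _) (@monomM _) word_star0 word_starD word_star_monom).
Qed.

Lemma word_starK : involutive word_star.
Proof.
exact: (spanned_starK (@monom_ind _) word_star0 word_starD word_star_monom (@conjCK _)).
Qed.

Lemma word_functional_monom c s : word_functional (monom c s) = c * boolean_moment kappa s.
Proof. exact: (@monalg.mmapU _ _ _ idfun). Qed.

Lemma word_functionalD g h : word_functional (g + h) = word_functional g + word_functional h.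
Proof. exact: (@monalg.mmapD _ _ _ idfun). Qed.

Lemma word_functional0 : word_functional 0 = 0.
Proof. exact: (@monalg.mmap0 _ _ _ idfun). Qed.

Lemma word_functional_is_linear : linear_for *%R word_functional.
Proof.
exact: (spanned_linear (@monom_ind _) (@monomZ _)
  word_functional0 word_functionalD word_functional_monom).
Qed.

HB.instance Definition _ :=
  GRing.isLinear.Build (CC R) B (CC R) *%R word_functional word_functional_is_linear.

Lemma word_functional1 : word_functional 1 = 1.
Proof. by rewrite -monom1 word_functional_monom mul1r. Qed.

Definition word_space : starNCPS R :=
  @StarNCPS R (word_algebra (CC R)) word_star word_starD word_starZ word_starM word_starK
    word_functional word_functional1.

Definition word_generator : word_space := monom 1 [:: false].

Lemma letter_word_generator (e : bool) :
  (if e then star word_generator else word_generator) = monom 1 [:: e].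
Proof.
case: e => //; rewrite -[LHS]/(word_star (monom 1 [:: false])).
by rewrite word_star_monom rmorph1.
Qed.

Lemma word_word_generator s : word star word_generator s = monom 1 s.
Proof.
rewrite /word; elim: s => [|e s IH] /=; first by rewrite big_nil monom1.
rewrite big_cons IH letter_word_generator.
by rewrite [LHS]monomM mulr1.
Qed.

(** The moments of the generator are built from [kappa], and moments determine cumulants. *)
Lemma bcumulant_word_generator s : (0 < size s)%N ->
  bcumulant (wletters star word_generator s) = kappa s.
Proof.
apply: (boolean_moment_inj (f := @bcumulant R word_space \o wletters star word_generator)).
move=> t; rewrite -phi_word word_word_generator.
by rewrite [LHS]word_functional_monom mul1r.
Qed.

End WordSpace.

(* [x N i j], for [i, j < N], is the entry of X_N in row [i] and column [j],
   indices starting at 0.  The values for [i >= N] or [j >= N] are irrelevant: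
   the limits only see [N > max i j]. *)
Theorem theorem3p4 (R : realType) (A : starNCPS R)
  (x : nat -> nat -> nat -> A) (alpha beta : nat -> CC R)
  (x_identically_distributed : forall N i j k l : nat,
     (i < N)%N -> (j < N)%N -> (k < N)%N -> (l < N)%N ->
     identically_distributed (x N i j) (x N k l))
  (x_independent : forall N : nat,
     boolean_independent_variables
       (fun p : 'I_N * 'I_N => x N p.1 p.2))
  (lim_alpha : forall i j m : nat, (0 < m)%N ->
     (fun N : nat => N%:R * phi ((x N i j * star (x N i j)) ^+ m) : CC R)
       @ \oo --> alpha m)
  (lim_beta : forall i j m : nat, (0 < m)%N ->
     (fun N : nat => N%:R * phi ((star (x N i j) * x N i j) ^+ m) : CC R)
       @ \oo --> beta m)
  (lim_moments : forall (i j : nat) (eps : R) (xi : seq bool),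
     eps < 1 -> (0 < size xi)%N ->
     (fun N : nat => (N%:R `^ eps)%:C%C * phi (word star (x N i j) xi) : CC R)
       @ \oo --> (0 : CC R)) :
  exists (B : starNCPS R) (b : B),
    [/\ B_diagonal b,
        has_determining_sequences b alpha beta &
        forall xi : seq bool, (0 < size xi)%N ->
          (fun N : nat =>
             phitr (word (@mxstar R A N) (\matrix_(i < N, j < N) x N i j) xi))
            @ \oo --> phi (word star b xi)].
Proof.
have sm xi : (0 < size xi)%N -> small (fun N => phi (word star (x N 0%N 0%N) xi)).
  by move=> xi0 eps e1; apply: lim_moments.
pose kappa := limit_cumulant alpha beta.
pose b := word_generator kappa.
have letters_pow (e : bool) n : wletters star b (flatten (nseq n [:: e; ~~ e])) =
    flatten (nseq n [:: if e then star b else b; if e then b else star b]).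
  by elim: n => //= n ->; case: e.
have kappa_pow (e : bool) n : (0 < n)%N ->
    bcumulant (flatten (nseq n [:: if e then star b else b; if e then b else star b])) =
    (if e then beta else alpha) n.
  move=> n0; have sz : size (flatten (nseq n [:: e; ~~ e])) = n.*2.
    by rewrite size_flatten /shape map_nseq sumn_nseq mulnC muln2.
  rewrite -letters_pow bcumulant_word_generator ?sz ?double_gt0 //.
  rewrite /kappa /limit_cumulant alternating_flatten sz doubleK.
  (* For positive [n] the head of the word is [e] and not the default value. *)
  by case: n n0 {sz}.
exists (word_space kappa), b; split.
- move=> xi xi0 Nxi; rewrite bcumulant_word_generator //.
  by rewrite /kappa /limit_cumulant (negbTE Nxi).
- by move=> n n0; rewrite (kappa_pow false) ?(kappa_pow true).
move=> xi xi0; rewrite word_word_generator.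
rewrite [phi _]word_functional_monom mul1r.
(* [phitr] is the normalized trace of the matrix of [phi]-values. *)
have := scalar_plus_small_trace (phi_matrix_word_asymptotic x_identically_distributed
  x_independent (lim_alpha 0%N 0%N) (lim_beta 0%N 0%N) sm xi).
apply: cvg_trans; apply: near_eq_cvg; apply: nearW => N.
by rewrite /phitr /mxtrace; congr (_ * _); apply: eq_bigr => i _; rewrite mxE.
Qed.
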